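(* Let $\mathcal H$ be a real Hilbert space, let $L\in\mathbb R^{n\times n}$ be lower triangular with diagonal entries less than $1$, let $c>0$, and let $(\mu_i)_{i=1}^n$, $(l_i)_{i=1}^n$ satisfy $0\le\mu_i<l_i$ for all $i\in[n]$. With $\tilde S$ the matrix-valued function defined in the context, consider the problem $$\begin{aligned}\min_{\phi,\lambda,\psi,\omega,\tilde W}\quad&\psi\\\text{subject to}\quad&\tilde S(\phi,\lambda,\psi,\omega,\tilde W)\succeq0,\\&\phi\ge0,\ \lambda\ge0,\\&\tilde W\mathbb 1=0,\\&\lambda_1(\tilde W)+\lambda_2(\tilde W)\ge c,\\&\phi,\lambda\in\mathbb R^n,\ \psi,\omega\in\mathbb R,\ \tilde W\in\mathbb S^n_+.\end{aligned}\qquad(\mathrm D)$$ Consider the iteration $$\mathbf x^k=J_{\mathbf A}(\mathbf v^k+\mathbf L\mathbf x^k),\qquad\mathbf v^{k+1}=\mathbf v^k-\gamma\mathbf W\mathbf x^k.\qquad(\mathrm I)$$ (i) If the values of $\gamma$ and $W$ are provided (with $\gamma W\in\mathbb S^n_+$ satisfying $\gamma W\mathbb 1=0$ and $\lambda_1(\gamma W)+\lambda_2(\gamma W)\ge c$), then fixing $\tilde W=\gamma W$ in $(\mathrm D)$ and optimizing over the remaining variables provides an optimal value which upper bounds the worst-case contraction factor $$\tau=\frac{\|\mathbf v_1^1-\mathbf v_2^1\|^2}{\|\mathbf v_1^0-\mathbf v_2^0\|^2}$$ of $(\mathrm I)$ over all initial values $\mathbf v_1^0\ne\mathbf v_2^0$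 (in $\{\mathbf v\in\mathcal H^n:\sum_iv_i=0\}$) and all possible $\mu_i$-strongly monotone $l_i$-Lipschitz operators $(A_i)_{i\in[n]}$. When $\dim(\mathcal H)\ge2n$, this bound is tight, i.e. the optimal value equals the supremum of $\tau$. (ii) If $\tilde W$ is optimized over, along with the remaining variables in $(\mathrm D)$, then setting $\gamma W=\tilde W$ in $(\mathrm I)$ is the choice of $\gamma W$ which minimizes the upper bound on the worst-case contraction factor in (i) over all matrices $\tilde W\in\mathbb S^n_+$ satisfying $\tilde W\mathbb 1=0$ and $\lambda_1(\tilde W)+\lambda_2(\tilde W)\ge c$. (iii) If $W$ is fixed but $\gamma$ is to be determined, then substituting $\tilde W=\gamma W$ in $(\mathrm D)$ and optimizing over $\gamma$ along with the remaining variables results in a choice of $\gamma$ which minimizes the upper bound on the worst-case contraction factor in (i) (over those $\gamma$ for which $\gamma W$ satisfies the constraints on $\tilde W$ in $(\mathrm D)$).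
   Context: Here $[n]=\{1,\dots,n\}$; $e_i\in\mathbb R^n$ is the $i$th standard basis vector, $\mathbb 1$ the all-ones vector, and $L_{i\cdot}$ the $i$th row of $L$. Define matrices in $\mathbb S^{2n}$ (blocks of size $n$): $$K_I=\begin{bmatrix}\mathrm{Id}&0\\0&0\end{bmatrix},\quad K_{\mathbb 1}=\begin{bmatrix}\mathbb 1\mathbb 1^T&0\\0&0\end{bmatrix},\quad K_{\mu_i}=\begin{bmatrix}0&\tfrac12e_ie_i^T\\\tfrac12e_ie_i^T&\tfrac12(e_iL_{i\cdot}+L_{i\cdot}^Te_i^T)-(1+\mu_i)e_ie_i^T\end{bmatrix},$$ $$K_{l_i}=\begin{bmatrix}-e_ie_i^T&-e_i(L_{i\cdot}-e_i^T)\\-(L_{i\cdot}-e_i^T)^Te_i^T&-(L_{i\cdot}-e_i^T)^T(L_{i\cdot}-e_i^T)+l_i^2e_ie_i^T\end{bmatrix},$$ and $$\tilde S(\phi,\lambda,\psi,\omega,\tilde W)=\begin{bmatrix}-\sum_i\phi_iK_{\mu_i}-\sum_i\lambda_iK_{l_i}+\psi K_I+\omega K_{\mathbb 1}&\begin{bmatrix}\mathrm{Id}\\-\tilde W\end{bmatrix}\\\begin{bmatrix}\mathrm{Id}&-\tilde W^T\end{bmatrix}&\mathrm{Id}\end{bmatrix}\in\mathbb S^{3n}.$$ $\mathbb S^m$ is the set of real symmetric $m\times m$ matrices, $\mathbb S^m_+$ the positive semidefinite ones, $\succeq$ the Loewner order, $\lambda_1(K)\le\lambda_2(K)\le\dots$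 the eigenvalues in increasing order. Bold matrices denote Kronecker lifts $\mathbf K=K\otimes\mathrm{Id}$ acting on $\mathcal H^n$. The operators $A_i$ are maximal monotone on $\mathcal H$, $\mathbf A(x_1,\dots,x_n)=A_1(x_1)\times\dots\times A_n(x_n)$, $J_{\mathbf A}=(\mathrm{Id}+\mathbf A)^{-1}$. $A$ is $\mu$-strongly monotone if $\langle x-y,u-v\rangle\ge\mu\|x-y\|^2$ for $u\in A(x),v\in A(y)$ ($\mu=0$ permitted, meaning monotone). $\mathbf v_1^1,\mathbf v_2^1$ are the results of one step of $(\mathrm I)$, with the same operators, from $\mathbf v_1^0,\mathbf v_2^0$; the fixed-point equation for $\mathbf x^k$ is solved component by component using the triangular structure of $L$. The optimal value is the infimum of the minimization problem. *)

(* Defs.v *)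
From HB Require Import structures.
From mathcomp Require Import all_boot all_order all_algebra.
From mathcomp Require Import polyrcf.
From mathcomp Require Import all_classical all_reals all_analysis.

Set Implicit Arguments.
Unset Strict Implicit.
Unset Printing Implicit Defensive.

Import Order.TTheory GRing.Theory Num.Theory.
Import numFieldNormedType.Exports.

Local Open Scope classical_set_scope.
Local Open Scope ring_scope.

Section Matrices.
Variable R : realType.

Definition psd m (K : 'M[R]_m) : Prop :=
  K^T = K /\ forall x : 'cV[R]_m, 0 <= (x^T *m K *m x) 0 0.

(* Real roots of the characteristic polynomial, increasing, each repeated
   according to its multiplicity; for symmetric K there are exactly m. *)
Definition eigvals m (K : 'M[R]_m) : seq R :=
  flatten [seq nseq (mup a (char_poly K)) a | a <- rootsR (char_poly K)].

(* eigval 1 K <= eigval 2 K <= ...: the index k starts at 1; junk value 0 out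
   of range *)
Definition eigval (k : nat) m (K : 'M[R]_m) : R := nth 0 (eigvals K) k.-1.

Variable n : nat.
Implicit Types (L W : 'M[R]_n) (mu l : 'I_n -> R).

Definition ones : 'cV[R]_n := const_mx 1.
Definition stdb (i : 'I_n) : 'cV[R]_n := delta_mx i 0.

Definition K_I : 'M[R]_(n + n) := block_mx 1%:M 0 0 0.

Definition K_1 : 'M[R]_(n + n) := block_mx (ones *m ones^T) 0 0 0.

Definition K_mu L mu (i : 'I_n) : 'M[R]_(n + n) :=
  let e := stdb i in
  block_mx 0                     (2^-1 *: (e *m e^T))
           (2^-1 *: (e *m e^T))  (2^-1 *: (e *m row i L + (row i L)^T *m e^T)
                                    - (1 + mu i) *: (e *m e^T)).

Definition K_l L l (i : 'I_n) : 'M[R]_(n + n) :=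
  let e := stdb i in
  let r := row i L - e^T in
  block_mx (- (e *m e^T))    (- (e *m r))
           (- (r^T *m e^T))  (- (r^T *m r) + (l i) ^+ 2 *: (e *m e^T)).

Record dual_var := DualVar {
  dphi : 'cV[R]_n;
  dlambda : 'cV[R]_n;
  dpsi : R;
  domega : R;
  dW : 'M[R]_n
}.

Definition S_tilde L mu l (p : dual_var) : 'M[R]_(n + n + n) :=
  block_mx
    (- (\sum_i dphi p i 0 *: K_mu L mu i) - (\sum_i dlambda p i 0 *: K_l L l i)
       + dpsi p *: K_I + domega p *: K_1)
    (col_mx 1%:M (- dW p))
    (row_mx 1%:M (- (dW p)^T))
    1%:M.

Definition admissible (c : R) W : Prop :=
  [/\ psd W, W *m ones = 0 & c <= eigval 1 W + eigval 2 W].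

Definition feasD L mu l (c : R) : set dual_var :=
  [set p | [/\ psd (S_tilde L mu l p),
               (forall i, 0 <= dphi p i 0),
               (forall i, 0 <= dlambda p i 0)
             & admissible c (dW p)]].

Definition feasD_fixed L mu l (c : R) W : set dual_var :=
  [set p | feasD L mu l c p /\ dW p = W].

(* the step size is an additional optimization variable *)
Definition feasD_scaled L mu l (c : R) W : set (R * dual_var) :=
  [set q | feasD L mu l c q.2 /\ dW q.2 = q.1 *: W].

(* Optimal value of: minimize f over F; +oo if F is empty. *)
Definition optval (X : Type) (F : set X) (f : X -> R) : \bar R :=
  ereal_inf [set (f x)%:E | x in F].

Definition optsol (X : Type) (F : set X) (f : X -> R) (x : X) : Prop :=
  F x /\ forall y, F y -> f x <= f y.

Definition rate_bound L mu l (c : R) W : \bar R :=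
  optval (feasD_fixed L mu l c W) dpsi.

End Matrices.

(* A set-valued operator on V is a function V -> set V. *)
Section Operators.
Variables (R : realType) (H : completeNormedModType R).
Variable dot : {dot H for idfun}.

Definition strongly_monotone (mu : R) (A : H -> set H) : Prop :=
  forall x y u v, A x u -> A y v -> mu * `|x - y| ^+ 2 <= dot (x - y) (u - v).

Definition maximal_monotone (A : H -> set H) : Prop :=
  strongly_monotone 0 A /\
  forall B : H -> set H, strongly_monotone 0 B ->
    (forall x, A x `<=` B x) -> B = A.

Definition lipschitz_op (l : R) (A : H -> set H) : Prop :=
  forall x y u v, A x u -> A y v -> `|u - v| <= l * `|x - y|.

Definition dim_ge (k : nat) : Prop :=
  exists e : 'I_k -> H,
    forall a : 'I_k -> R, \sum_i a i *: e i = 0 -> forall i, a i = 0.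

(* z in x + A x *)
Definition resolvent (V : zmodType) (A : V -> set V) : V -> set V :=
  fun z => [set x | exists2 u, A x u & x + u = z].

Variable n : nat.
Implicit Types v x : {ffun 'I_n -> H}.

Definition sqnorm v : R := \sum_i `|v i| ^+ 2.

Definition prod_op (A : 'I_n -> H -> set H) :
    {ffun 'I_n -> H} -> set {ffun 'I_n -> H} :=
  fun x => [set u | forall i, A i (x i) (u i)].

(* the Kronecker lift of K, i.e. K tensor Id *)
Definition klift (K : 'M[R]_n) x : {ffun 'I_n -> H} :=
  [ffun i => \sum_j K i j *: x j].

(* One step of the iteration. The resolvent of a maximal monotone operator is
   single-valued, so membership below is the equation x = J_A (v + L x). *)
Definition iter_step (L : 'M[R]_n) (gamma : R) (W : 'M[R]_n)
    (A : 'I_n -> H -> set H) v x v' : Prop :=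
  resolvent (prod_op A) (v + klift L x) x /\ v' = v - gamma *: klift W x.

Definition op_class (mu l : 'I_n -> R) (A : 'I_n -> H -> set H) : Prop :=
  forall i, [/\ maximal_monotone (A i), strongly_monotone (mu i) (A i)
              & lipschitz_op (l i) (A i)].

Definition contraction_ratios (L : 'M[R]_n) (mu l : 'I_n -> R)
    (gamma : R) (W : 'M[R]_n) : set R :=
  [set tau | exists A v1 x1 v1' v2 x2 v2',
    [/\ op_class mu l A,
        [/\ \sum_i v1 i = 0, \sum_i v2 i = 0 & v1 <> v2],
        iter_step L gamma W A v1 x1 v1', iter_step L gamma W A v2 x2 v2'
      & tau = sqnorm (v1' - v2') / sqnorm (v1 - v2)]].

Definition worst_case (L : 'M[R]_n) (mu l : 'I_n -> R)
    (gamma : R) (W : 'M[R]_n) : \bar R :=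
  ereal_sup [set tau%:E | tau in contraction_ratios L mu l gamma W].

End Operators.
Arguments dim_ge {R} H k.

(* Main.v *)
Require Import Defs.
From HB Require Import structures.
From mathcomp Require Import all_boot all_order all_algebra.
From mathcomp Require Import all_classical all_reals all_analysis.
From mathcomp Require Import ring lra.

Set Implicit Arguments.
Unset Strict Implicit.
Unset Printing Implicit Defensive.

Import Order.TTheory GRing.Theory Num.Theory.
Import numFieldNormedType.Exports.

Local Open Scope classical_set_scope.
Local Open Scope ring_scope.

(** One step of the iteration turns the differences [v], [x] of two runs into
    [v - W x], where [u_i = v_i + (L x)_i - x_i] is the difference of the values
    of the [i]th operator. Strong monotonicity and Lipschitz continuity say that
    [<x_i, u_i> >= mu_i |x_i|^2] and [|u_i|^2 <= l_i^2 |x_i|^2]; these, like the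
    squared norms of [v], of the sum of the [v_i] and of [v - W x], are pairings
    [\tr (K *m G)] of the matrices of the dual problem with the Gram matrix [G]
    of the [2n] vectors [v_i], [x_i] (lemmas [tr_K_mu], [tr_K_l], [tr_K_1],
    [tr_K_I], [tr_update]).

    Upper bound. By the Schur complement ([psd_schur]) a dual feasible point is a
    semidefinite matrix [dual_slack]. Its pairing with the Gram matrix is
    nonnegative because both matrices are semidefinite ([psd_mxtrace_ge0]), which
    is the required inequality ([weak_duality]).

    Tightness. Let [psi] exceed the worst-case factor. Minimizing the sum of the
    squared constraint violations over the compact set of semidefinite matrices
    of unit trace gives a theorem of alternatives ([psd_alternative]). If some
    matrix satisfies all the constraints and has objective at least [psi], it is
    a Gram matrix of vectors of [H], since [H] has dimension at least [2n]
    ([psd_realization]), and linear operators, a multiple of the identity plus a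
    skew map, realize these vectors as one step of the iteration started at [v]
    and at [0] ([two_point_operator]); this contradicts the choice of [psi].
    Otherwise nonnegative multipliers make a combination of the constraint
    matrices negative definite. The multiplier of the objective is positive,
    because the operators [mu_i Id] produce a point satisfying the other
    constraints ([exists_linear_trajectory]); dividing by it gives a dual
    feasible point of value [psi] ([strong_duality]).

    The statements on the choice of [W] or of the step size hold because a joint
    infimum is the infimum of the partial infima ([optval_bigcup]). *)

(** * Positive semidefinite matrices *)

Section PSD.
Variable R : realType.

Lemma mxtrace_rank1 m (K : 'M[R]_m) (x y : 'cV[R]_m) :
  \tr (K *m (x *m y^T)) = (y^T *m K *m x) 0 0.
Proof. by rewrite mulmxA mxtrace_mulC mulmxA trace_mx11. Qed.

Lemma qf_outer m (a b x : 'cV[R]_m) :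
  (x^T *m (a *m b^T) *m x) 0 0 = (a^T *m x) 0 0 * (b^T *m x) 0 0.
Proof.
rewrite mulmxA -mulmxA mxE big_ord1; congr (_ * _).
by rewrite -[RHS]trace_mx11 -mxtrace_tr trmx_mul trmxK trace_mx11.
Qed.

(** A quadratic polynomial in [t] without negative values has nonpositive
    discriminant; [g = 0] is allowed. *)
Lemma quad_ge0_disc (q b g : R) :
  (forall t, 0 <= q + (t * b) *+ 2 + t ^+ 2 * g) -> b ^+ 2 <= q * g.
Proof.
move=> h; have q0 := h 0; rewrite expr2 !mul0r mul0rn !addr0 in q0.
have [g0|g0] := eqVneq g 0.
  have [->|b0] := eqVneq b 0; first by rewrite g0 expr2 !mulr0.
  have := h (- (q + 1) / (2 * b)); rewrite g0.
  have -> : q + (- (q + 1) / (2 * b) * b) *+ 2 + (- (q + 1) / (2 * b)) ^+ 2 * 0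
    = -1 by field.
  lra.
have h1 : 0 <= g.
  rewrite leNgt; apply/negP => gn.
  (* at this t the quadratic is at most -1 *)
  have := h (`|b| *+ 2 / (- g) + (q + 1) / (- g) + 1).
  set s := - g; have s0 : 0 < s by rewrite oppr_gt0.
  set u := `|b| *+ 2 / s; set w := (q + 1) / s.
  have us : u * s = `|b| *+ 2 by rewrite divfK ?gt_eqF.
  have ws : w * s = q + 1 by rewrite divfK ?gt_eqF.
  have u0 : 0 <= u by rewrite divr_ge0 ?mulrn_wge0 // ltW.
  have w0 : 0 <= w by rewrite divr_ge0 ?(ltW s0) //; lra.
  set t := u + w + 1.
  have bb : b <= `|b| := ler_norm b.
  have t1 : 1 <= t by rewrite /t; lra.
  have tb : t * b <= t * `|b| by rewrite ler_wpM2l//; lra.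
  have -> : g = - s by rewrite opprK.
  have -> : t ^+ 2 * - s = - (t * (u * s + w * s + s)) by rewrite /t; ring.
  rewrite us ws => h2.
  have h3 : 0 <= (t - 1) * (q + 1 + s) by rewrite mulr_ge0; lra.
  lra.
have gp : 0 < g by rewrite lt0r g0.
have := h (- b / g).
have -> : q + (- b / g * b) *+ 2 + (- b / g) ^+ 2 * g = (q * g - b ^+ 2) / g.
  by field.
by rewrite pmulr_lge0 ?invr_gt0 // subr_ge0.
Qed.

Lemma psd_CauchySchwarz m (G : 'M[R]_m) (x y : 'cV[R]_m) : psd G ->
  ((x^T *m G *m y) 0 0) ^+ 2 <= (x^T *m G *m x) 0 0 * (y^T *m G *m y) 0 0.
Proof.
move=> [Gs G0]; apply: quad_ge0_disc => t.
have yx : (y^T *m G *m x) 0 0 = (x^T *m G *m y) 0 0.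
  rewrite -[LHS]trace_mx11 -mxtrace_tr trace_mx11.
  by rewrite !trmx_mul trmxK Gs mulmxA.
have := G0 (x + t *: y); rewrite [(_ + _)^T]linearD /= [(t *: y)^T]linearZ /=.
have D (A B : 'M[R]_1) : (A + B) 0 0 = A 0 0 + B 0 0 by rewrite mxE.
have Z a (A : 'M[R]_1) : (a *: A) 0 0 = a * A 0 0 by rewrite mxE.
rewrite !mulmxDl !mulmxDr -!scalemxAl -!scalemxAr !(D, Z) yx.
by congr (0 <= _); ring.
Qed.

Lemma delta_qf m (G : 'M[R]_m) i j :
  ((delta_mx i 0 : 'cV[R]_m)^T *m G *m (delta_mx j 0 : 'cV[R]_m)) 0 0 = G i j.
Proof. by rewrite trmx_delta -rowE -colE !mxE. Qed.

Lemma psd_diag_ge0 m (G : 'M[R]_m) i : psd G -> 0 <= G i i.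
Proof. by case=> _ /(_ (delta_mx i 0)); rewrite delta_qf. Qed.

Lemma psd_entry m (G : 'M[R]_m) i j : psd G -> (G i j) ^+ 2 <= G i i * G j j.
Proof.
by move=> /(psd_CauchySchwarz (delta_mx i 0) (delta_mx j 0)); rewrite !delta_qf.
Qed.

Lemma psd_outer m (x : 'cV[R]_m) : psd (x *m x^T).
Proof.
split=> [|y]; first by rewrite trmx_mul trmxK.
by rewrite qf_outer -expr2 sqr_ge0.
Qed.

Lemma psdD m (G G' : 'M[R]_m) : psd G -> psd G' -> psd (G + G').
Proof.
move=> [s p] [s' p']; split=> [|x]; first by rewrite linearD /= s s'.
by rewrite mulmxDr mulmxDl mxE addr_ge0.
Qed.

Lemma psdZ m a (G : 'M[R]_m) : 0 <= a -> psd G -> psd (a *: G).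
Proof.
move=> a0 [s p]; split=> [|x]; first by rewrite linearZ /= s.
by rewrite -scalemxAr -scalemxAl mxE mulr_ge0.
Qed.

(** One step of symmetric Gaussian elimination: subtracting the normalized
    outer square of a column clears that column and its row and keeps the
    matrix positive semidefinite.  When the pivot is zero the whole column is zero, and the
    convention that the inverse of zero is zero makes the step trivial. *)
Lemma psd_pivot m (G : 'M[R]_m) i (w := (Num.sqrt (G i i))^-1 *: col i G) :
  psd G ->
  [/\ psd (G - w *m w^T),
      forall j, (G - w *m w^T) i j = 0
    & forall k, (forall j, G k j = 0) -> forall j, (G - w *m w^T) k j = 0].
Proof.
move=> psdG; have [Gs Gp] := psdG.
have Gii := psd_diag_ge0 i psdG.
have GC k j : G k j = G j k by rewrite -{1}Gs mxE.
have wE k j : (w *m w^T) k j = (G i i)^-1 * (G k i * G j i).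
  rewrite /w linearZ /= -scalemxAl -scalemxAr scalerA mxE -invfM -expr2 sqr_sqrtr//.
  by rewrite mxE big_ord1 !mxE.
split.
- split=> [|x]; first by rewrite linearB /= Gs trmx_mul trmxK.
  rewrite mulmxBr mulmxBl mxE [X in _ + X]mxE qf_outer -expr2 subr_ge0.
  have -> : (w^T *m x) 0 0 = (Num.sqrt (G i i))^-1
      * (x^T *m G *m (delta_mx i 0 : 'cV_m)) 0 0.
    rewrite -[LHS]trace_mx11 -mxtrace_tr trmx_mul trmxK trace_mx11.
    by rewrite /w -scalemxAr mxE -mulmxA -colE.
  rewrite exprMn exprVn sqr_sqrtr//.
  have := psd_CauchySchwarz x (delta_mx i 0) psdG; rewrite delta_qf => cs.
  have [->|gi0] := eqVneq (G i i) 0; first by rewrite invr0 mul0r.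
  by rewrite mulrC ler_pdivrMr // lt0r gi0.
- move=> j; rewrite mxE [X in _ + X]mxE wE (GC j i).
  have [gi0|gi0] := eqVneq (G i i) 0; last by rewrite mulKf// subrr.
  have := psd_entry i j psdG; rewrite gi0 invr0 !mul0r subr0 => h.
  by apply/eqP; rewrite -sqrf_eq0 eq_le h sqr_ge0.
- move=> k Gk j; rewrite mxE [X in _ + X]mxE wE Gk Gk mul0r mulr0 subr0 //.
Qed.

Lemma psd_sum_outer m (G : 'M[R]_m) : psd G ->
  exists w : 'I_m -> 'cV[R]_m, G = \sum_k w k *m (w k)^T.
Proof.
move=> psdG.
have step k : (k <= m)%N -> exists w : 'I_k -> 'cV[R]_m,
    psd (G - \sum_j w j *m (w j)^T) /\
    forall i : 'I_m, (i < k)%N ->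
      forall j, (G - \sum_j w j *m (w j)^T) i j = 0.
  elim: k => [_|k IHk km].
    by exists (fun=> 0); split=> //; rewrite big_ord0 subr0.
  have [w [wp w0]] := IHk (ltnW km).
  pose i0 := Ordinal km.
  have [] := psd_pivot i0 wp; set u := (_ *: _) => up ui uk.
  exists (fun i : 'I_k.+1 => if unlift ord_max i is Some j then w j else u).
  have sumE : \sum_(k0 < k.+1) (if unlift ord_max k0 is Some j then w j else u)
        *m (if unlift ord_max k0 is Some j then w j else u)^T
      = \sum_(k0 < k) w k0 *m (w k0)^T + u *m u^T.
    rewrite big_ord_recr /= unlift_none; congr (_ + _).
    apply: eq_bigr => j _.
    by have -> : widen_ord (leqnSn k) j = lift ord_max j;
      [apply: val_inj; rewrite /= /bump leqNgt ltn_ord | rewrite liftK].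
  rewrite sumE opprD addrA; split=> // i; rewrite ltnS leq_eqVlt => /orP[/eqP ik|ik] j.
    have -> : i = i0 by apply: val_inj.
    by rewrite ui.
  by rewrite uk// => j'; rewrite w0.

have [w [_ w0]] := step m (leqnn m).
exists w; apply/eqP; rewrite -subr_eq0; apply/eqP/matrixP => i j.
by rewrite w0 // mxE.
Qed.

(** The easy half of the self-duality of the semidefinite cone. *)
Lemma psd_mxtrace_ge0 m (K G : 'M[R]_m) : psd K -> psd G -> 0 <= \tr (K *m G).
Proof.
move=> [_ K0] /psd_sum_outer[w ->].
rewrite mulmx_sumr raddf_sum; apply: sumr_ge0 => k _ /=.
by rewrite mxtrace_rank1.
Qed.

End PSD.

(** * A theorem of alternatives over the cone of semidefinite matrices *)

Section Alternatives.
Variable R : realType.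

Lemma continuous_sumr (T : topologicalType) (I : finType) (f : I -> T -> R) :
  (forall i, continuous (f i)) -> continuous (fun x => \sum_i f i x).
Proof.
move=> fc x; apply: cvg_big => [|i _]; first exact: add_continuous.
exact: fc.
Qed.

Lemma continuousMr_cst (T : topologicalType) (a : R) (f : T -> R) :
  continuous f -> continuous (fun x => a * f x).
Proof. by move=> fc x; apply: cvgMr; exact: fc. Qed.

Lemma mxtrace_mul_continuous m (K : 'M[R]_m) :
  continuous (fun g : 'rV[R]_(m * m) => \tr (K *m vec_mx g)).
Proof.
move=> g; have -> : (fun g : 'rV[R]_(m * m) => \tr (K *m vec_mx g))
    = (fun g => \sum_i \sum_j K i j * g 0 (mxvec_index j i)).
  by apply/funext => g'; apply: eq_bigr => i _; rewrite mxE;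
    apply: eq_bigr => j _; rewrite mxE.
move: g; apply: continuous_sumr => i; apply: continuous_sumr => j.
by apply: continuousMr_cst; exact: coord_continuous.
Qed.

(** Semidefinite matrices of unit trace, flattened to row vectors. *)
Definition spectraplex m : set 'rV[R]_(m * m) :=
  [set g | psd (vec_mx g) /\ \tr (vec_mx g) = 1].

Lemma spectraplex_closed m : closed (@spectraplex m).
Proof.
have cpre (f : 'rV[R]_(m * m) -> R) (D : set R) : continuous f -> closed D ->
    closed (f @^-1` D).
  by move=> cf cD; apply: preimage_closed => // x _; apply: cf.
have -> : @spectraplex m =
    (\bigcap_(ij in [set: 'I_m * 'I_m])
       (fun g => \tr ((delta_mx ij.2 ij.1 - delta_mx ij.1 ij.2) *m vec_mx g))
          @^-1` [set x | x = 0])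
    `&` (\bigcap_(x in [set: 'cV[R]_m])
       (fun g => \tr ((x *m x^T) *m vec_mx g)) @^-1` [set x | 0 <= x])
    `&` (fun g => \tr (1%:M *m vec_mx g)) @^-1` [set x | x = 1].
  have E (G : 'M[R]_m) i j : \tr (delta_mx j i *m G) = G i j.
    rewrite /mxtrace (bigD1 j) //= big1 ?addr0 => [|k kj]; last first.
      rewrite mxE big1 // => a _.
      by rewrite mxE (negbTE kj) mul0r.
    rewrite mxE (bigD1 i) //= big1 ?addr0 => [|a ai].
      by rewrite mxE !eqxx mul1r.
    by rewrite mxE (negbTE ai) andbF mul0r.
  apply/seteqP; split=> g /=.
    move=> [[gs gp] gt]; split; last by rewrite mul1mx.
    split=> [[i j] _ /=|x _ /=].
      by rewrite mulmxBl linearB /= !E -{1}gs mxE subrr.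
    by rewrite mxtrace_mulC mxtrace_rank1.
  rewrite mul1mx => -[[gs gp] gt]; split=> //; split=> [|x].
    apply/matrixP => i j; rewrite mxE; apply/eqP; rewrite -subr_eq0.
    by have /= := gs (j, i) I; rewrite mulmxBl linearB /= !E => ->.
  by have /= := gp x I; rewrite mxtrace_mulC mxtrace_rank1.
apply: closedI; last first.
  by apply: cpre; [exact: mxtrace_mul_continuous | exact: closed_eq].
apply: closedI; apply: closed_bigI => i _; apply: cpre.
- exact: mxtrace_mul_continuous.
- exact: closed_eq.
- exact: mxtrace_mul_continuous.
- exact: closed_ge.
Qed.

Lemma spectraplex_compact m : compact (@spectraplex m).
Proof.
have cV : compact [set v : 'rV[R]_(m * m) | forall k, v ord0 k \in `[- 1, 1]].
  apply: (@rV_compact R (m * m) (fun=> `[(- 1 : R), 1]%classic)) => _.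
  exact: segment_compact.
apply: (subclosed_compact (@spectraplex_closed m) cV).
move=> g [gp gt] k; case/mxvec_indexP: k => i j.
  rewrite -[g]vec_mxK mxvecE in_itv /= -ler_norml.
  have d1 a : vec_mx g a a <= 1.
    rewrite -gt /mxtrace (bigD1 a)//= lerDl; apply: sumr_ge0 => b _.
    exact: psd_diag_ge0.
  have := psd_entry i j gp; move: (d1 i) (d1 j) (psd_diag_ge0 i gp).
  move: (psd_diag_ge0 j gp) => j0 i1 j1 i0 h.
  have {}h : vec_mx g i j ^+ 2 <= 1.
    by apply: le_trans h _; rewrite -[leRHS]mulr1 ler_pM.
  by rewrite ler_norml; apply/andP; split; nra.
Qed.

(** First-order optimality: if moving from [y] in the direction [- d] does not
    decrease the sum of squares, then [<y, d> <= 0]. *)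
Lemma sumsq_first_order (I : finType) (y d : I -> R) :
  (forall t, 0 < t <= 1 -> \sum_k y k ^+ 2 <= \sum_k (y k - t * d k) ^+ 2) ->
  \sum_k y k * d k <= 0.
Proof.
set s := \sum_k y k * d k => h; rewrite leNgt; apply/negP => s0.
pose D := \sum_k d k ^+ 2.
have D0 : 0 <= D by apply: sumr_ge0 => k _; exact: sqr_ge0.
have Dp : 0 < D + s + 1 by lra.
have st1 : 0 < s / (D + s + 1) <= 1.
  by rewrite divr_gt0//= ler_pdivrMr//; lra.
have := h _ st1; set t := s / _ in st1 *.
have -> : \sum_k (y k - t * d k) ^+ 2
    = \sum_k y k ^+ 2 - 2 * t * s + t ^+ 2 * D.
  rewrite /D /s !mulr_sumr -sumrN -!big_split /=; apply: eq_bigr => k _.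
  ring.
have tD : t * D < s.
  rewrite /t mulrAC ltr_pdivrMr // ltr_pM2l //; lra.
have /andP[t0 _] := st1.
nra.
Qed.

(** Either some semidefinite matrix of unit trace has a nonnegative pairing
    with every [F k], or a nonnegative combination of the [F k] is negative
    definite. The multipliers are the constraint violations at a point of the
    spectraplex where the sum of their squares is minimal. *)
Lemma psd_alternative m (I : finType) (F : I -> 'M[R]_m) :
  (forall G, psd G -> \tr G = 1 -> ~ forall k, 0 <= \tr (F k *m G)) ->
  exists2 y : I -> R, forall k, 0 <= y k &
    forall x : 'cV[R]_m, x != 0 -> \sum_k y k * (x^T *m F k *m x) 0 0 < 0.
Proof.
move=> noG; have [[z z0]|nz] := pselect (exists z : 'cV[R]_m, z != 0); last first.
  by exists (fun=> 0) => // x x0; case: nz; exists x.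
have nrm (x : 'cV[R]_m) : x != 0 -> 0 < \tr (x *m x^T).
  have p k : 0 <= x^T 0 k * x k 0 by rewrite mxE -expr2 sqr_ge0.
  move=> x0; rewrite mxtrace_mulC trace_mx11 mxE lt0r; apply/andP; split.
    apply: contraNN x0 => /eqP h; apply/eqP/matrixP => i j; rewrite ord1 mxE.
    have /eqP := psumr_eq0P (fun k _ => p k) h (i := i) isT.
    by rewrite mxE mulf_eq0 orbb => /eqP.
  by apply: sumr_ge0 => k _.
have unit (x : 'cV[R]_m) : x != 0 ->
    psd ((\tr (x *m x^T))^-1 *: (x *m x^T)) /\
    \tr ((\tr (x *m x^T))^-1 *: (x *m x^T)) = 1.
  move=> /nrm x0; split.
    by apply: psdZ; [rewrite invr_ge0 ltW | exact: psd_outer].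
  by rewrite linearZ /= mulVf ?gt_eqF.
pose viol (g : 'rV[R]_(m * m)) k : R := Num.max 0 (- \tr (F k *m vec_mx g)).
pose V g := \sum_k viol g k ^+ 2.
have Vc : {within @spectraplex m, continuous V}.
  apply: continuous_subspaceT; apply: continuous_sumr => k g.
  have vc : {for g, continuous (fun g => viol g k)}.
    apply: (@continuous_max R _ (fun=> 0)); first exact: cst_continuous.
    apply: continuousN; exact: mxtrace_mul_continuous.
  exact: (continuousM vc vc).
have ne : @spectraplex m !=set0.
  exists (mxvec ((\tr (z *m z^T))^-1 *: (z *m z^T))).
  by rewrite /spectraplex /= mxvecK; exact: unit.
have [g] := compact_EVT_min ne (@spectraplex_compact m) Vc.
rewrite inE => -[gp gt] gmin.
pose y := viol g; exists y => [k|x x0]; first by rewrite le_max lexx.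
set f := fun k => \tr (F k *m vec_mx g).
have yf k : - y k <= f k by rewrite lerNl le_max lexx orbT.
have yfE k : y k * f k = - y k ^+ 2.
  rewrite /y /viol -/(f k); case: (leP 0 (- f k)) => _; last first.
    by rewrite expr2 !mul0r oppr0.
  by ring.
have [Gp Gt] := unit x x0; move: Gp Gt; set c := (\tr _)^-1.
move GE : (c *: _) => G Gp Gt.
have c0 : 0 < c by rewrite invr_gt0 nrm.
have /sumsq_first_order : forall t, 0 < t <= 1 ->
    \sum_k y k ^+ 2 <= \sum_k (y k - t * (\tr (F k *m G) - f k)) ^+ 2.
  move=> t /andP[t0 t1].
  pose gt' := mxvec ((1 - t) *: vec_mx g + t *: G).
  have gt'S : gt' \in @spectraplex m.
    rewrite inE /spectraplex /= mxvecK; split.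
      by apply: psdD; apply: psdZ => //; [rewrite subr_ge0|exact: ltW].
    by rewrite mxtraceD !mxtraceZ gt Gt; ring.
  apply: le_trans (gmin _ gt'S) _; apply: ler_sum => k _.
  rewrite /viol mxvecK mulmxDr mxtraceD -!scalemxAr !mxtraceZ -/(f k).
  case: (leP 0) => h; last by rewrite expr2 mul0r sqr_ge0.
  by rewrite ler_sqr ?nnegrE //; have := yf k; lra.
rewrite (eq_bigr (fun k => y k * \tr (F k *m G) + y k ^+ 2)); last first.
  by move=> k _; rewrite mulrBr yfE opprK.
rewrite big_split /= => h.
have s0 : 0 < \sum_k y k ^+ 2.
  rewrite lt0r sumr_ge0 ?andbT => [|k _]; last exact: sqr_ge0.
  apply/eqP => /psumr_eq0P y0; apply: (noG _ gp gt) => k.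
  have /eqP := y0 (fun k _ => sqr_ge0 _) k isT; rewrite sqrf_eq0 => /eqP yk.
  by have := yf k; rewrite yk oppr0.
have : \sum_k y k * \tr (F k *m G) < 0 by lra.
rewrite (eq_bigr (fun k => c * (y k * (x^T *m F k *m x) 0 0))); last first.
  by move=> k _; rewrite -GE -scalemxAr linearZ /= mxtrace_rank1 mulrCA.
by rewrite -mulr_sumr pmulr_rlt0.
Qed.

End Alternatives.

(** * Geometry of the inner product space *)

Section InnerProduct.
Variables (R : realType) (H : completeNormedModType R).
Variable dot : {dot H for idfun}.

Lemma dotC x y : dot x y = dot y x.
Proof. by rewrite (hermC dot) expr0 mul1r. Qed.

Lemma dotDl x y z : dot (x + y) z = dot x z + dot y z.
Proof. exact: linearDl. Qed.

Lemma dotDr x y z : dot z (x + y) = dot z x + dot z y.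
Proof. exact: linearDr. Qed.

Lemma dotBr x y z : dot z (x - y) = dot z x - dot z y.
Proof. exact: linearBr. Qed.

Lemma dotZl a x z : dot (a *: x) z = a * dot x z.
Proof. exact: linearZl_LR. Qed.

Lemma dotZr a x z : dot z (a *: x) = a * dot z x.
Proof. exact: linearZr_LR. Qed.

Lemma dot0l z : dot 0 z = 0.
Proof. exact: linear0l. Qed.

Lemma dot0r z : dot z 0 = 0.
Proof. exact: linear0r. Qed.

Lemma dot_suml (I : finType) (f : I -> H) z :
  dot (\sum_i f i) z = \sum_i dot (f i) z.
Proof. exact: linear_sumlz. Qed.

Lemma dot_sumr (I : finType) (f : I -> H) z :
  dot z (\sum_i f i) = \sum_i dot z (f i).
Proof. exact: linear_sumr. Qed.

Lemma dot_gt0 x : x != 0 -> 0 < dot x x.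
Proof. exact: neq0_dnorm_gt0. Qed.

Lemma dot_ge0 x : 0 <= dot x x.
Proof.
by have [->|/dot_gt0/ltW//] := eqVneq x 0; rewrite dot0l.
Qed.

Lemma dot_eq0 x : dot x x = 0 -> x = 0.
Proof. by move=> x0; apply/eqP; apply: contraT => /dot_gt0; rewrite x0 ltxx. Qed.

Lemma dotNl x z : dot (- x) z = - dot x z.
Proof. exact: linearNl. Qed.

Lemma dotNr x z : dot z (- x) = - dot z x.
Proof. exact: linearNr. Qed.

Definition dotE := (dotDl, dotDr, dotNl, dotNr, dotZl, dotZr).

Section Gram.
Variable m : nat.
Implicit Types (z : 'I_m -> H) (a b : 'cV[R]_m).

(** The linear combination of the family [z] with coefficients [a]. *)
Definition lincomb a z : H := \sum_i a i 0 *: z i.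

(** The Gram matrix of the family [z]. *)
Definition gram z : 'M[R]_m := \matrix_(i, j) dot (z i) (z j).

Lemma mxtrace_gram a b z :
  \tr (a *m b^T *m gram z) = dot (lincomb a z) (lincomb b z).
Proof.
rewrite -mulmxA mxtrace_mulC trace_mx11 mxE /lincomb dot_suml.
apply: eq_bigr => j _; rewrite dotZl mulrC dot_sumr mxE; congr (_ * _).
by apply: eq_bigr => i _; rewrite !mxE dotZr dotC.
Qed.

Lemma psd_gram z : psd (gram z).
Proof.
split=> [|x]; first by apply/matrixP => i j; rewrite !mxE dotC.
by rewrite -mxtrace_rank1 mxtrace_mulC mxtrace_gram dot_ge0.
Qed.

End Gram.

Lemma lincomb_col_mx p q (a : 'cV[R]_p) (b : 'cV[R]_q) (z : 'I_(p + q) -> H) :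
  lincomb (col_mx a b) z
  = lincomb a (z \o @lshift p q) + lincomb b (z \o @rshift p q).
Proof.
rewrite /lincomb big_split_ord; congr (_ + _); apply: eq_bigr => i _ /=.
  by rewrite col_mxEu.
by rewrite col_mxEd.
Qed.

Lemma lincomb_delta m (z : 'I_m -> H) i : lincomb (delta_mx i 0) z = z i.
Proof.
rewrite /lincomb (bigD1 i)//= mxE !eqxx scale1r big1 ?addr0// => j ji.
by rewrite mxE (negbTE ji) scale0r.
Qed.

Lemma lincombB m (a b : 'cV[R]_m) (z : 'I_m -> H) :
  lincomb (a - b) z = lincomb a z - lincomb b z.
Proof.
rewrite /lincomb -sumrB; apply: eq_bigr => i _.
by rewrite !mxE scalerBl.
Qed.

Lemma lincomb0 m (z : 'I_m -> H) : lincomb 0 z = 0.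
Proof. by rewrite /lincomb big1 // => i _; rewrite mxE scale0r. Qed.

Lemma dim_ge_orthonormal N k : dim_ge H N -> (k <= N)%N ->
  exists b : 'I_k -> H, forall i j, dot (b i) (b j) = (i == j)%:R.
Proof.
move=> [e e_free]; elim: k => [_|k IHk kN]; first by exists (fun=> 0) => -[].
have [b bb] := IHk (ltnW kN).
(* [k < N] linear conditions leave a nontrivial combination orthogonal to [b] *)
pose D : 'M[R]_(N, k) := \matrix_(i, j) dot (e i) (b j).
have kerD : kermx D != 0.
  by rewrite -mxrank_eq0 mxrank_ker subn_eq0 -ltnNge (leq_ltn_trans (rank_leq_col _)).
have [r rD0] : exists r, row r (kermx D) != 0.
  apply: contrapT => /forallNP h; case/eqP: kerD; apply/row_matrixP => r.
  by rewrite row0; apply/eqP; apply: contrapT => /negP; exact: h.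
pose a i := kermx D r i; pose z := \sum_i a i *: e i.
have z0 : z != 0.
  apply: contraNneq rD0 => /e_free a0; apply/eqP/rowP => i.
  by rewrite mxE [RHS]mxE; exact: a0.
have zo j : dot z (b j) = 0.
  have <- : (kermx D *m D) r j = 0 by rewrite mulmx_ker mxE.
  by rewrite [RHS]mxE dot_suml; apply: eq_bigr => i _; rewrite dotZl [D i j]mxE.
pose u := (Num.sqrt (dot z z))^-1 *: z.
have uu : dot u u = 1.
  rewrite dotZl dotZr mulrA -invfM -expr2 sqr_sqrtr ?dot_ge0//.
  by rewrite mulVf // gt_eqF // dot_gt0.
have uo j : dot u (b j) = 0 by rewrite dotZl zo mulr0.
exists (fun i : 'I_k.+1 => if unlift ord_max i is Some j then b j else u) => i j.
case: unliftP => [i' ->|->]; case: unliftP => [j' ->|->].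
- by rewrite bb (inj_eq (@lift_inj _ _)).
- by rewrite dotC uo eq_sym (negbTE (neq_lift _ _)).
- by rewrite uo (negbTE (neq_lift _ _)).
- by rewrite eqxx.
Qed.

Lemma psd_realization m (G : 'M[R]_m) : dim_ge H m -> psd G ->
  exists z : 'I_m -> H, gram z = G.
Proof.
move=> Hm /psd_sum_outer[w ->].
have [b bb] := dim_ge_orthonormal Hm (leqnn m).
exists (fun i => \sum_k w k i 0 *: b k); apply/matrixP => i j.
rewrite !mxE summxE dot_suml; apply: eq_bigr => k _.
rewrite dotZl dot_sumr (bigD1 k)//= dotZr bb eqxx mulr1 big1 => [|k' kk'].
  by rewrite addr0 mxE big_ord1 mxE.
by rewrite dotZr bb eq_sym (negbTE kk') mulr0.
Qed.

Hypothesis dot_norm : forall x : H, dot x x = `|x| ^+ 2.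

Section LinearOperator.
Variables (f : H -> H) (mu l : R).
Hypothesis f_lin : forall a x y, f (a *: x + y) = a *: f x + f y.
Hypothesis mu_ge0 : 0 <= mu.
Hypothesis f_mono : forall x, mu * `|x| ^+ 2 <= dot x (f x).
Hypothesis f_lip : forall x, `|f x| <= l * `|x|.

Let fB x y : f (x - y) = f x - f y.
Proof. by rewrite addrC -scaleN1r f_lin scaleN1r addrC. Qed.

Lemma graph_strongly_monotone : strongly_monotone dot mu (fun x => [set f x]).
Proof. by move=> x y _ _ -> ->; rewrite -fB. Qed.

Lemma graph_lipschitz : lipschitz_op l (fun x => [set f x]).
Proof. by move=> x y _ _ -> ->; rewrite -fB. Qed.

(** Minty's trick: if [(y, w)] is monotonically related to the graph of [f],
    testing against [y - t h] with [h = f y - w] and small [t] forces [h = 0]. *)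
Lemma graph_maximal_monotone : maximal_monotone dot (fun x => [set f x]).
Proof.
split=> [x y _ _ -> ->|B Bmono fB_sub].
  rewrite mul0r -fB; apply: le_trans (f_mono _).
  by rewrite mulr_ge0 // sqr_ge0.
apply/funext => y; apply/seteqP; split=> [w Byw|w]; last exact: fB_sub.
suff h0 : f y - w = 0 by apply/esym/eqP; rewrite -subr_eq0 h0.
set h := f y - w; apply: dot_eq0; apply/eqP; rewrite eq_le dot_ge0 andbT leNgt.
apply/negP => hh.
set M := dot h (f h).
have M0 : 0 <= M by apply: le_trans (f_mono h); rewrite mulr_ge0 // sqr_ge0.
pose t := dot h h / (M + 1).
have t0 : 0 < t by rewrite divr_gt0 //; lra.
have tM : t * M < dot h h.
  by rewrite mulrAC ltr_pdivrMr ?ltr_pM2l; lra.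
have := Bmono y (y - t *: h) w (f (y - t *: h)) Byw (fB_sub _ _ erefl).
have -> : y - (y - t *: h) = t *: h by rewrite opprB addrC subrK.
have ft : f (y - t *: h) = f y - t *: f h.
  by rewrite addrC -scaleNr f_lin scaleNr addrC.
have -> : w - f (y - t *: h) = t *: f h - h.
  by rewrite ft /h !opprB addrCA.
rewrite mul0r dotZl dotBr dotZr -/M pmulr_rge0 //.
lra.
Qed.

End LinearOperator.

(** Two-point interpolation: the linear map is a multiple of the identity plus
    a skew map in the plane of [x] and the component [w] of [u] orthogonal
    to [x]. *)
Lemma two_point_operator (mu l : R) (x u : H) : 0 <= mu < l ->
  mu * `|x| ^+ 2 <= dot x u -> `|u| <= l * `|x| ->
  exists A : H -> set H,
    [/\ maximal_monotone dot A, strongly_monotone dot mu A, lipschitz_op l A,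
        A 0 0 & A x u].
Proof.
move=> /andP[mu0 mul] xu ul.
have l0 : 0 < l by apply: le_lt_trans mul.
suff [f [f_lin f_mono f_lip fx]] : exists f : H -> H,
   [/\ forall a x y, f (a *: x + y) = a *: f x + f y,
       forall x, mu * `|x| ^+ 2 <= dot x (f x),
       forall x, `|f x| <= l * `|x| & f x = u].
  exists (fun y => [set f y]); split=> //.
  - exact: (graph_maximal_monotone f_lin mu0 f_mono).
  - exact: (graph_strongly_monotone f_lin f_mono).
  - exact: (graph_lipschitz f_lin f_lip).
  - have := f_lin 0 0 0; rewrite !scale0r !add0r => h.
    by apply/esym; have := f_lin 1 0 0; rewrite !scale1r addr0 => /eqP;
      rewrite -subr_eq0 opprD addNKr oppr_eq0 => /eqP.
have [x0|x0] := eqVneq x 0.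
  exists (fun y => mu *: y); split.
  - by move=> a y z; rewrite scalerDr !scalerA mulrC.
  - by move=> y; rewrite dotZr dot_norm.
  - by move=> y; rewrite normrZ ger0_norm // ler_wpM2r // ltW.
  - by move: ul; rewrite x0 normr0 mulr0 normr_le0 scaler0 => /eqP.
pose p := dot x x; have p0 : 0 < p by exact: dot_gt0.
pose a := dot x u / p.
have ap : a * p = dot x u by rewrite divfK // gt_eqF.
have [w uE] : exists w, u = a *: x + w.
  by exists (u - a *: x); rewrite addrC subrK.
have xw : dot x w = 0.
  by apply: (addrI (dot x u)); rewrite addr0 {2}uE dotDr dotZr -/p ap.
have wx : dot w x = 0 by rewrite dotC.
exists (fun y => a *: y + p^-1 *: (dot y x *: w - dot y w *: x)); split.
- move=> b y z; rewrite !dotDl !dotZl !scalerDl opprD addrACA -!scalerA -scalerBr.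
  by rewrite !scalerDr !scalerA ![_ * b]mulrC addrACA.
- move=> y; rewrite dotDr !dotZr dotBr !dotZr -!dot_norm.
  have -> : dot y x * dot y w - dot y w * dot y x = 0 by ring.
  rewrite mulr0 addr0 ler_wpM2r ?dot_ge0 // ler_pdivlMr //.
  by rewrite /p dot_norm.
- move=> y; rewrite -(@ler_pXn2r _ 2) ?nnegrE ?mulr_ge0 ?(ltW l0) //.
  rewrite exprMn -!dot_norm !dotE.
  rewrite xw wx [dot w y]dotC [dot x y]dotC -/p.
  set Y := dot y y; set s := dot y x; set r := dot y w; set q := dot w w.
  have Y0 : 0 <= Y by exact: dot_ge0.
  have pE : p = dot x x by [].
  have uq : a ^+ 2 * p + q <= l ^+ 2 * p.
    move: ul; rewrite -(@ler_pXn2r _ 2) ?nnegrE ?mulr_ge0 ?(ltW l0) //.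
    rewrite exprMn -!dot_norm -pE uE !dotE xw wx -pE -/q.
    by congr (_ <= _); ring.
  (* Bessel's inequality, cleared of denominators *)
  have bessel : s ^+ 2 * q + r ^+ 2 * p <= Y * p * q.
    have [/dot_eq0 w0|q0] := eqVneq q 0.
      by rewrite /q /r w0 !dot0r expr0n /= !mulr0 mul0r addr0.
    have q1 : 0 < q by rewrite lt0r q0 dot_ge0.
    have := dot_ge0 (y - (s / p) *: x - (r / q) *: w).
    rewrite !dotE xw wx [dot w y]dotC [dot x y]dotC -/p -/q -/s -/r -/Y => h.
    have -> : Y * p * q = s ^+ 2 * q + r ^+ 2 * p
        + p * q * (Y - s ^+ 2 / p - r ^+ 2 / q).
      by field; rewrite q0 gt_eqF.
    rewrite lerDl mulr_ge0 //; first by rewrite mulr_ge0 // ltW.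
    apply: le_trans h _; rewrite le_eqVlt; apply/orP; left; apply/eqP.
    by field; rewrite q0 gt_eqF.
  rewrite [leLHS](_ : _ = (a ^+ 2 * p * Y * p + (s ^+ 2 * q + r ^+ 2 * p)) / p ^+ 2);
    last by field; rewrite gt_eqF.
  rewrite ler_pdivrMr ?exprn_gt0 //.
  have := ler_wpM2r (mulr_ge0 Y0 (ltW p0)) uq.
  lra.
- rewrite xw scale0r subr0 scalerA -/p mulVf ?gt_eqF // scale1r.
  by rewrite uE.
Qed.

End InnerProduct.

(** * The matrices of the dual problem as Gram pairings *)

Section Blocks.
Variable R : realType.

Lemma mulmx_tr_sum p q (M : 'M[R]_(p, q)) :
  M *m M^T = \sum_i col i M *m (col i M)^T.
Proof.
apply/matrixP => i j; rewrite !mxE summxE; apply: eq_bigr => k _.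
by rewrite !mxE big_ord1 !mxE.
Qed.

Lemma qf_block p q (Q : 'M[R]_p) (B : 'M[R]_(p, q)) a b (c := B^T *m a + b) :
  ((col_mx a b)^T *m block_mx Q B B^T 1%:M *m col_mx a b) 0 0
  = (a^T *m (Q - B *m B^T) *m a) 0 0 + (c^T *m c) 0 (0 : 'I_1).
Proof.
have D (A A' : 'M[R]_1) : (A + A') 0 0 = A 0 0 + A' 0 0 by rewrite mxE.
have N (A : 'M[R]_1) : (- A) 0 0 = - A 0 0 by rewrite mxE.
rewrite /c tr_col_mx mul_row_block mul_row_col mulmx1 [(_ + b)^T]linearD /=.
rewrite trmx_mul trmxK !(mulmxDl, mulmxDr, mulmxN, mulNmx) !mulmxA !(D, N).
ring.
Qed.

(** The Schur complement criterion for a unit lower-right block. *)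
Lemma psd_schur p q (Q : 'M[R]_p) (B : 'M[R]_(p, q)) :
  psd (block_mx Q B B^T 1%:M) <-> psd (Q - B *m B^T).
Proof.
split=> -[Ks Kp]; split.
- move: Ks; rewrite tr_block_mx => /eq_block_mx[Qs _ _ _].
  by rewrite linearB /= Qs trmx_mul trmxK.
- move=> a; have := Kp (col_mx a (- (B^T *m a))).
  by rewrite qf_block addrN trmx0 mul0mx [X in _ + X]mxE addr0.
- have Qs : Q^T = Q.
    apply: (addIr (- (B *m B^T))); rewrite -[RHS]Ks linearB /= trmx_mul trmxK //.
  by rewrite tr_block_mx Qs trmxK trmx1.
- move=> x; rewrite -[x]vsubmxK qf_block addr_ge0 //.
  rewrite mxE; apply: sumr_ge0 => i _; rewrite mxE -expr2; exact: sqr_ge0.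
Qed.

Variable n : nat.
Implicit Types (L W : 'M[R]_n) (mu l : 'I_n -> R).

(** Coefficient vectors of the linear forms [(v, x) |-> x_i] and
    [(v, x) |-> v_i + (L x)_i - x_i]; the latter reads off the value of
    the [i]th operator at [x_i]. *)
Definition argv (i : 'I_n) : 'cV[R]_(n + n) := col_mx 0 (stdb R i).

Definition valv L (i : 'I_n) : 'cV[R]_(n + n) :=
  col_mx (stdb R i) ((row i L)^T - stdb R i).

Lemma K_mu_outer L mu i : K_mu L mu i =
  2^-1 *: (argv i *m (valv L i)^T + valv L i *m (argv i)^T)
  - mu i *: (argv i *m (argv i)^T).
Proof.
rewrite /K_mu /argv /valv !tr_col_mx !mul_col_row !trmx0 !mulmx0 !mul0mx.
rewrite add_block_mx scale_block_mx scale_block_mx opp_block_mx add_block_mx.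
set e := stdb R i; set r := row i L.
rewrite !(scaler0, add0r, addr0, oppr0); congr block_mx.
rewrite [(r^T - e)^T]linearB /= trmxK mulmxBr mulmxBl.
rewrite [e *m r - _ + _]addrACA -opprD scalerBr -mulr2n.
rewrite -[e *m e^T *+ 2]scaler_nat scalerA.
by rewrite mulVf ?pnatr_eq0 // scale1r scalerDl scale1r opprD addrA.
Qed.

Lemma K_l_outer L l i : K_l L l i =
  - (valv L i *m (valv L i)^T) + l i ^+ 2 *: (argv i *m (argv i)^T).
Proof.
rewrite /K_l /argv /valv !tr_col_mx !mul_col_row !trmx0 !mulmx0 !mul0mx.
rewrite scale_block_mx opp_block_mx add_block_mx !scaler0 !addr0.
by rewrite [(row i L - _)^T]linearB /= !trmxK [((row i L)^T - _)^T]linearB /= trmxK.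
Qed.

Lemma K_1_outer : K_1 R n = col_mx (ones R n) 0 *m (col_mx (ones R n) 0)^T.
Proof. by rewrite tr_col_mx mul_col_row !trmx0 !mulmx0 !mul0mx. Qed.

Lemma K_I_outer : K_I R n =
  col_mx 1%:M (0 : 'M[R]_n) *m (col_mx 1%:M (0 : 'M[R]_n))^T.
Proof. by rewrite tr_col_mx mul_col_row !trmx0 !mulmx0 !mul0mx trmx1 mulmx1. Qed.

End Blocks.

Section GramPairing.
Variables (R : realType) (H : completeNormedModType R).
Variables (dot : {dot H for idfun}) (n : nat).
Implicit Types (L W : 'M[R]_n) (mu l : 'I_n -> R) (v x : 'I_n -> H).

(** The family [v_1, ..., v_n, x_1, ..., x_n]. *)
Definition block_family v x (k : 'I_(n + n)) : H :=
  match fintype.split k with inl i => v i | inr i => x i end.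

Lemma block_familyK (z : 'I_(n + n) -> H) :
  block_family (z \o @lshift n n) (z \o @rshift n n) = z.
Proof.
by apply/funext => k; rewrite /block_family /= -{2}[k]splitK; case: (fintype.split k).
Qed.

Lemma lincomb_block_family a b v x :
  lincomb (col_mx a b) (block_family v x) = lincomb a v + lincomb b x.
Proof.
rewrite lincomb_col_mx; congr (_ + _); apply: eq_bigr => i _ /=.
  by rewrite /block_family (unsplitK (inl i)).
by rewrite /block_family (unsplitK (inr i)).
Qed.

(** The value of the [i]th operator forced by one step of the iteration. *)
Definition opval L v x i : H := v i + \sum_j L i j *: x j - x i.

Lemma lincomb_argv v x i : lincomb (argv R i) (block_family v x) = x i.
Proof. by rewrite lincomb_block_family lincomb0 add0r lincomb_delta. Qed.

Lemma lincomb_valv L v x i : lincomb (valv L i) (block_family v x) = opval L v x i.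
Proof.
rewrite lincomb_block_family lincombB !lincomb_delta addrA; congr (_ + _ - _).
by apply: eq_bigr => j _; rewrite !mxE.
Qed.

Lemma tr_K_mu L mu i v x : \tr (K_mu L mu i *m gram dot (block_family v x)) =
  dot (x i) (opval L v x i) - mu i * dot (x i) (x i).
Proof.
rewrite K_mu_outer mulmxBl -!scalemxAl mulmxDl linearB /= !mxtraceZ mxtraceD.
rewrite !mxtrace_gram lincomb_argv lincomb_valv [dot (opval _ _ _ _) _]dotC.
by field.
Qed.

Lemma tr_K_l L l i v x : \tr (K_l L l i *m gram dot (block_family v x)) =
  l i ^+ 2 * dot (x i) (x i) - dot (opval L v x i) (opval L v x i).
Proof.
rewrite K_l_outer mulmxDl mulNmx -!scalemxAl mxtraceD linearN /= mxtraceZ.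
by rewrite !mxtrace_gram lincomb_argv lincomb_valv addrC.
Qed.

Lemma tr_K_1 v x : \tr (K_1 R n *m gram dot (block_family v x)) =
  dot (\sum_i v i) (\sum_i v i).
Proof.
rewrite K_1_outer mxtrace_gram lincomb_block_family lincomb0 addr0.
by congr (dot _ _); apply: eq_bigr => i _; rewrite mxE scale1r.
Qed.

Lemma tr_mulmx_tr q (M : 'M[R]_(n + n, q)) z :
  \tr (M *m M^T *m gram dot z) =
  \sum_i dot (lincomb (col i M) z) (lincomb (col i M) z).
Proof.
rewrite mulmx_tr_sum mulmx_suml raddf_sum; apply: eq_bigr => i _ /=.
exact: mxtrace_gram.
Qed.

Lemma tr_K_I v x : \tr (K_I R n *m gram dot (block_family v x)) =
  \sum_i dot (v i) (v i).
Proof.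
rewrite K_I_outer tr_mulmx_tr; apply: eq_bigr => i _.
by rewrite col_col_mx col0 colE mul1mx lincomb_block_family lincomb0 addr0 lincomb_delta.
Qed.

Lemma tr_update W v x (M := col_mx 1%:M (- W)) : W^T = W ->
  \tr (M *m M^T *m gram dot (block_family v x)) =
  \sum_i dot (v i - \sum_j W i j *: x j) (v i - \sum_j W i j *: x j).
Proof.
move=> Ws; rewrite tr_mulmx_tr; apply: eq_bigr => i _.
rewrite col_col_mx colE mul1mx lincomb_block_family lincomb_delta.
suff -> : lincomb (col i (- W)) x = - \sum_j W i j *: x j by [].
rewrite /lincomb -sumrN; apply: eq_bigr => j _.
by rewrite !mxE scaleNr -{1}Ws mxE.
Qed.

End GramPairing.

(** * Weak and strong duality *)

Section Duality.
Variables (R : realType) (n : nat).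
Variables (L : 'M[R]_n) (mu l : 'I_n -> R).

(** The Schur complement of the identity block of [S_tilde]. *)
Definition dual_slack (p : dual_var R n) : 'M[R]_(n + n) :=
  let M := col_mx 1%:M (- dW p) in
  - (\sum_i dphi p i 0 *: K_mu L mu i) - (\sum_i dlambda p i 0 *: K_l L l i)
  + dpsi p *: K_I R n + domega p *: K_1 R n - M *m M^T.

Lemma psd_S_tilde p : psd (S_tilde L mu l p) <-> psd (dual_slack p).
Proof.
rewrite /S_tilde; set M := col_mx _ _.
have -> : row_mx 1%:M (- (dW p)^T) = M^T.
  by rewrite tr_col_mx trmx1 linearN.
exact: psd_schur.
Qed.

Lemma K_mu_sym i : (K_mu L mu i)^T = K_mu L mu i.
Proof.
rewrite K_mu_outer linearB /= !linearZ /= linearD /= !trmx_mul !trmxK.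
by rewrite [X in _ *: X]addrC.
Qed.

Lemma K_l_sym i : (K_l L l i)^T = K_l L l i.
Proof. by rewrite K_l_outer linearD linearN /= linearZ /= !trmx_mul !trmxK. Qed.

Lemma K_1_sym : (K_1 R n)^T = K_1 R n.
Proof. by rewrite K_1_outer trmx_mul trmxK. Qed.

Lemma K_I_sym : (K_I R n)^T = K_I R n.
Proof. by rewrite K_I_outer trmx_mul trmxK. Qed.

Hypothesis L_trig : is_trig_mx L.
Hypothesis L_diag : forall i, L i i < 1.
Hypothesis mu_l : forall i, 0 <= mu i < l i.

(** A real point with nonzero centred [c] compatible with the operators
    [mu_i Id], solving a triangular system with positive diagonal. *)
Lemma exists_linear_trajectory : (2 <= n)%N ->
  exists c d : 'cV[R]_n, [/\ \sum_i c i 0 = 0, c != 0 &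
    forall i, c i 0 + \sum_j L i j * d j 0 - d i 0 = mu i * d i 0].
Proof.
move=> n2; pose i0 := Ordinal (ltn_trans (ltnSn 0) n2); pose i1 := Ordinal n2.
have i10 : (i1 == i0) = false by [].
pose c : 'cV[R]_n := delta_mx i0 0 - delta_mx i1 0.
pose T := diag_mx (\row_i (1 + mu i)) - L.
have Tu : T \in unitmx.
  rewrite unitmxE unitfE det_trig; last first.
    apply/is_trig_mxP => i j ij; rewrite !mxE.
    have -> : (i == j) = false by apply: ltn_eqF.
    by move/is_trig_mxP : L_trig => ->; rewrite // mulr0n subrr.
  apply/prodf_neq0 => i _; rewrite !mxE eqxx mulr1n gt_eqF //.
  by have /andP[] := mu_l i; have := L_diag i; lra.
exists c, (invmx T *m c); split.
- under eq_bigr do rewrite !mxE.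
  rewrite sumrB (bigD1 i0)//= big1 => [|i /negbTE ->//].
  by rewrite (bigD1 i1)//= big1 ?addr0 ?eqxx ?subrr // => i /negbTE ->.
- apply/eqP => /matrixP/(_ i0 0); rewrite !mxE eqxx eq_sym i10 /= subr0.
  by apply/eqP; exact: oner_neq0.
- move=> i; set d := invmx T *m c.
  have -> : c = T *m d by rewrite mulKVmx.
  rewrite mulmxBl mul_diag_mx !mxE.
  ring.
Qed.

Section Space.
Variables (H : completeNormedModType R) (dot : {dot H for idfun}).

Lemma tr_dual_slack p (v x : 'I_n -> H) : (dW p)^T = dW p ->
  \tr (dual_slack p *m gram dot (block_family v x)) =
  - (\sum_i dphi p i 0 * (dot (x i) (opval L v x i) - mu i * dot (x i) (x i)))
  - (\sum_i dlambda p i 0 *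
       (l i ^+ 2 * dot (x i) (x i) - dot (opval L v x i) (opval L v x i)))
  + dpsi p * (\sum_i dot (v i) (v i))
  + domega p * dot (\sum_i v i) (\sum_i v i)
  - \sum_i dot (v i - \sum_j dW p i j *: x j) (v i - \sum_j dW p i j *: x j).
Proof.
move=> Ws; rewrite /dual_slack !mulmxDl !mulNmx !mxtraceD !linearN /=.
have trS (a : 'I_n -> R) (K : 'I_n -> 'M[R]_(n + n)) G :
    \tr ((\sum_i a i *: K i) *m G) = \sum_i a i * \tr (K i *m G).
  rewrite mulmx_suml linear_sum; apply: eq_bigr => i _.
  by rewrite -scalemxAl /= mxtraceZ.
rewrite tr_update // -!scalemxAl !mxtraceZ tr_K_I tr_K_1 !trS.
do 3![congr (_ + _)]; congr (- _ - _); apply: eq_bigr => i _.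
  by rewrite tr_K_mu.
by rewrite tr_K_l.
Qed.

(** The constraints that strong monotonicity and Lipschitz continuity impose
    on the differences [v], [x] of two runs of one step. *)
Definition step_constraints (v x : 'I_n -> H) : Prop :=
  forall i, mu i * dot (x i) (x i) <= dot (x i) (opval L v x i) /\
    dot (opval L v x i) (opval L v x i) <= l i ^+ 2 * dot (x i) (x i).

Lemma weak_duality p (v x : 'I_n -> H) :
  psd (S_tilde L mu l p) -> (forall i, 0 <= dphi p i 0) ->
  (forall i, 0 <= dlambda p i 0) -> (dW p)^T = dW p ->
  \sum_i v i = 0 -> step_constraints v x ->
  \sum_i dot (v i - \sum_j dW p i j *: x j) (v i - \sum_j dW p i j *: x j)
  <= dpsi p * \sum_i dot (v i) (v i).
Proof.
move=> /psd_S_tilde Sp phi0 lam0 Ws v0 vx.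
have := psd_mxtrace_ge0 Sp (psd_gram dot (block_family v x)).
rewrite tr_dual_slack // v0 dot0l mulr0 addr0.
have : 0 <= \sum_i dphi p i 0 *
    (dot (x i) (opval L v x i) - mu i * dot (x i) (x i)).
  by apply: sumr_ge0 => i _; rewrite mulr_ge0 // subr_ge0; case: (vx i).
have : 0 <= \sum_i dlambda p i 0 *
    (l i ^+ 2 * dot (x i) (x i) - dot (opval L v x i) (opval L v x i)).
  by apply: sumr_ge0 => i _; rewrite mulr_ge0 // subr_ge0; case: (vx i).
lra.
Qed.

(** Forward substitution along the triangular [L]: equal inputs give equal
    resolvent points. *)
Lemma step_constraints_inj (v x : 'I_n -> H) :
  step_constraints v x -> (forall i, v i = 0) -> forall i, x i = 0.
Proof.
move=> vx v0 i; have [k] := ubnP (i : nat).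
elim: k i => // k IHk i; rewrite ltnS => ik.
have uE : opval L v x i = (L i i - 1) *: x i.
  rewrite /opval v0 add0r (bigD1 i) //= big1 => [|j ji].
    by rewrite addr0 scalerBl scale1r.
  have [ij|ij|/val_inj ij] := ltngtP i j; last by rewrite ij eqxx in ji.
    by move/is_trig_mxP : L_trig => ->; rewrite // scale0r.
  by rewrite IHk ?scaler0 // (leq_trans ij).
have [+ _] := vx i; rewrite uE dotZr => h.
apply: (@dot_eq0 _ _ dot); apply/eqP; rewrite eq_le dot_ge0 andbT leNgt; apply/negP => xx.
have /andP[m0 _] := mu_l i; have Li := L_diag i.
have : 0 <= mu i * dot (x i) (x i) by rewrite mulr_ge0 // ltW.
have : 0 < (1 - L i i) * dot (x i) (x i) by rewrite mulr_gt0 // subr_gt0.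
lra.
Qed.

Lemma strong_duality (W : 'M[R]_n) (psi : R) : (2 <= n)%N -> W^T = W ->
  dim_ge H (2 * n)%N ->
  (forall v x : 'I_n -> H, \sum_i v i = 0 -> (exists i, v i != 0) ->
    step_constraints v x ->
    \sum_i dot (v i - \sum_j W i j *: x j) (v i - \sum_j W i j *: x j)
    < psi * \sum_i dot (v i) (v i)) ->
  exists p : dual_var R n, [/\ psd (S_tilde L mu l p),
    forall i, 0 <= dphi p i 0, forall i, 0 <= dlambda p i 0,
    dW p = W & dpsi p = psi].
Proof.
move=> n2 Ws; rewrite mul2n -addnn => dimH contr.
pose M : 'M[R]_(n + n, n) := col_mx 1%:M (- W).
(* The constraint that the [v_i] sum to zero needs only the matrix [- K_1],
   since [K_1] is semidefinite. *)
pose F (k : ('I_n + 'I_n) + bool) : 'M[R]_(n + n) :=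
  match k with
  | inl (inl i) => K_mu L mu i
  | inl (inr i) => K_l L l i
  | inr true => - K_1 R n
  | inr false => M *m M^T - psi *: K_I R n
  end.
have [G psdG trG FG|y y0 yF] := @psd_alternative R (n + n) _ F.
  (* a feasible matrix is the Gram matrix of vectors violating [contr] *)
  have [z zG] := psd_realization dot dimH psdG.
  pose v := z \o @lshift n n; pose x := z \o @rshift n n.
  have {}zG : gram dot (block_family v x) = G by rewrite block_familyK.
  have vx : step_constraints v x.
    move=> i; split.
      by have := FG (inl (inl i)); rewrite -zG tr_K_mu subr_ge0.
    by have := FG (inl (inr i)); rewrite -zG tr_K_l subr_ge0.
  have v0 : \sum_i v i = 0.
    apply: (@dot_eq0 _ _ dot); apply/eqP; rewrite eq_le dot_ge0 andbT.
    have := FG (inr true); rewrite -zG mulNmx linearN /= tr_K_1.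
    by rewrite oppr_ge0.
  have [vn0|/forallNP vz] := pselect (exists i, v i != 0).
    have := contr v x v0 vn0 vx.
    have := FG (inr false); rewrite -zG mulmxBl linearB /= tr_update //.
    rewrite -scalemxAl mxtraceZ tr_K_I; lra.
  have {}vz i : v i = 0 by apply/eqP/negPn/negP; exact: vz.
  have xz := step_constraints_inj vx vz.
  have := trG; rewrite -zG /mxtrace big1 => [/eqP|k _].
    by rewrite eq_sym oner_eq0.
  rewrite mxE /block_family; case: (fintype.split k) => i.
    by rewrite vz dot0l.
  by rewrite xz dot0l.
(* The multiplier of the objective cannot vanish: the Gram matrix of a
   trajectory of the operators [mu_i Id] satisfies all the other constraints. *)
have yP : 0 < y (inr false).
  rewrite lt0r y0 andbT; apply/eqP => yz.
  have n1 : (1 <= n + n)%N by apply: leq_trans (ltnW n2) (leq_addr n n).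
  have [b bb] := dim_ge_orthonormal dot dimH n1.
  have {bb} := bb 0 0; set h := b 0; rewrite eqxx => hh.
  have [c [d [c0 cn0 cd]]] := exists_linear_trajectory n2.
  pose v i := c i 0 *: h; pose x i := d i 0 *: h.
  have gE : gram dot (block_family v x) = col_mx c d *m (col_mx c d)^T.
    apply/matrixP => i j; rewrite !mxE big_ord1 /block_family !mxE.
    by case: (fintype.split i) => i'; case: (fintype.split j) => j';
      rewrite dotZl dotZr hh mulr1.
  have uE i : opval L v x i = mu i *: x i.
    rewrite /opval /v /x scalerA -cd scalerBl scalerDl scaler_suml.
    by congr (_ + _ - _); apply: eq_bigr => j _; rewrite scalerA.
  have vS : \sum_i v i = 0 by rewrite -scaler_suml c0 scale0r.
  clearbody v x.
  have := yF (col_mx c d); rewrite col_mx_eq0 (negbTE cn0) => /(_ isT).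
  apply/negP; rewrite -leNgt.
  apply: sumr_ge0 => k _; rewrite -mxtrace_rank1 -gE.
  have [m0 ml] : (forall i, 0 <= mu i) /\ forall i, mu i < l i.
    by split=> i; have /andP[] := mu_l i.
  case: k => [[i|i]|[|]] /=; last by rewrite yz mul0r.
  - by rewrite mulr_ge0 // tr_K_mu uE dotZr subrr.
  - rewrite mulr_ge0 // tr_K_l uE dotZr dotZl mulrA -expr2 -mulrBl.
    rewrite mulr_ge0 ?dot_ge0 //.
    by rewrite subr_ge0 ler_sqr ?nnegrE // ?ltW // (le_lt_trans (m0 i)).
  - rewrite mulr_ge0 // mulNmx linearN /= tr_K_1 vS.
    by rewrite dot0l oppr0.
set s := y (inr false) in yP.
pose p := DualVar (\col_i (s^-1 * y (inl (inl i)))) (\col_i (s^-1 * y (inl (inr i))))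
  psi (s^-1 * y (inr true)) W.
have slackE : dual_slack p = - s^-1 *: \sum_k y k *: F k.
  rewrite !big_sumType /= big_bool /= -/s /dual_slack /= -/M.
  rewrite !scalerDr -!addrA !scaler_sumr; congr (_ + _).
    rewrite -sumrN; apply: eq_bigr => i _.
    by rewrite mxE scalerA mulNr scaleNr.
  congr (_ + _).
    rewrite -sumrN; apply: eq_bigr => i _.
    by rewrite mxE scalerA mulNr scaleNr.
  rewrite addrCA; congr (_ + _).
    by rewrite scalerA mulNr scaleNr scalerN opprK.
  by rewrite !scalerA mulNr mulVf ?gt_eqF // !scaleN1r opprK addrC.
have slackS : (dual_slack p)^T = dual_slack p.
  rewrite slackE linearZ /= raddf_sum /=; congr (_ *: _); apply: eq_bigr => k _.
  rewrite linearZ /=; congr (_ *: _); case: k => [[i|i]|[|]] /=.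
  - exact: K_mu_sym.
  - exact: K_l_sym.
  - by rewrite linearN /= K_1_sym.
  - by rewrite linearB /= linearZ /= K_I_sym trmx_mul trmxK.
exists p; split=> //=.
- apply/psd_S_tilde; split=> // a.
  have [->|a0] := eqVneq a 0; first by rewrite trmx0 !mul0mx mxE.
  rewrite slackE -scalemxAr -scalemxAl mxE mulNr -mulrN mulr_ge0 ?invr_ge0 ?ltW //.
  rewrite oppr_gt0 mulmx_sumr mulmx_suml summxE.
  rewrite (eq_bigr (fun k => y k * (a^T *m F k *m a) 0 0)) ?yF// => k _.
  by rewrite -scalemxAr -scalemxAl mxE.
- by move=> i; rewrite mxE mulr_ge0 // invr_ge0 ltW.
- by move=> i; rewrite mxE mulr_ge0 // invr_ge0 ltW.
Qed.

End Space.
End Duality.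

(** * Infima over families of feasible sets *)

Section OptimalValues.
Variable R : realType.
Local Open Scope ereal_scope.

Lemma optval_le (X : Type) (F : set X) (f : X -> R) x :
  F x -> optval F f <= (f x)%:E.
Proof. by move=> Fx; apply: ereal_inf_lbound; exists x. Qed.

Lemma optsol_optval (X : Type) (F : set X) (f : X -> R) x :
  optsol F f x -> optval F f = (f x)%:E.
Proof.
move=> [Fx xmin]; apply/eqP; rewrite eq_le optval_le //=.
by apply: le_ereal_inf_tmp => _ [y Fy <-]; rewrite lee_fin xmin.
Qed.

(** Minimizing jointly is minimizing the partial optimal values. *)
Lemma optval_bigcup (X Y I : Type) (P : set I) (F : I -> set X) (f : X -> R)
    (G : set Y) (g : Y -> R) :
  (forall i, P i -> forall x, F i x -> exists2 y, G y & g y = f x) ->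
  (forall y, G y -> exists2 i, P i & exists2 x, F i x & f x = g y) ->
  optval G g = ereal_inf [set optval (F i) f | i in P].
Proof.
move=> FG GF; apply/eqP; rewrite eq_le; apply/andP; split.
  apply: le_ereal_inf_tmp => _ [i Pi <-]; apply: le_ereal_inf_tmp => _ [x Fx <-].
  by have [y Gy <-] := FG i Pi x Fx; exact: optval_le.
apply: le_ereal_inf_tmp => _ [y Gy <-]; have [i Pi [x Fx <-]] := GF y Gy.
by apply: le_trans (optval_le f Fx); apply: ereal_inf_lbound; exists i.
Qed.

Lemma ereal_inf_eq_min (I : Type) (P : set I) (r : I -> \bar R) j : P j ->
  r j = ereal_inf [set r i | i in P] <-> forall i, P i -> r j <= r i.
Proof.
move=> Pj; split=> [-> i Pi|h].
  by apply: ereal_inf_lbound; exists i.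
apply/eqP; rewrite eq_le; apply/andP; split.
  by apply: le_ereal_inf_tmp => _ [i Pi <-]; exact: h.
by apply: ereal_inf_lbound; exists j.
Qed.

End OptimalValues.

(** * Worst-case contraction *)

Section WorstCase.
Variables (R : realType) (H : completeNormedModType R).
Variable dot : {dot H for idfun}.
Hypothesis dot_norm : forall x : H, dot x x = `|x| ^+ 2.
Variables (n : nat) (L : 'M[R]_n) (mu l : 'I_n -> R).
Hypothesis L_trig : is_trig_mx L.
Hypothesis L_diag : forall i, L i i < 1.
Hypothesis mu_l : forall i, 0 <= mu i < l i.

Lemma iter_stepP gamma W (A : 'I_n -> H -> set H) v x v' :
  iter_step L gamma W A v x v' <->
  (forall i, A i (x i) (opval L v x i)) /\
  (forall i, v' i = v i - \sum_j (gamma *: W) i j *: x j).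
Proof.
have opE u : x + u = v + klift L x -> forall i, u i = opval L v x i.
  move=> e i; have := congr1 (fun f : {ffun 'I_n -> H} => f i) e.
  by rewrite !ffunE => e'; rewrite /opval -e' addrAC subrr add0r.
have updE i : (v - gamma *: klift W x) i = v i - \sum_j (gamma *: W) i j *: x j.
  rewrite !ffunE scaler_sumr; congr (_ - _); apply: eq_bigr => j _.
  by rewrite scalerA mxE.
split=> [[[u Au e] ->]|[Ax v'E]].
  by split=> i; [rewrite -(opE u) //; exact: Au | exact: updE].
split; last by apply/ffunP => i; rewrite v'E updE.
exists [ffun i => opval L v x i]; first by move=> i /=; rewrite ffunE.
by apply/ffunP => i; rewrite !ffunE /opval addrC subrK.
Qed.

Lemma sqnorm_dot (v : {ffun 'I_n -> H}) : sqnorm v = \sum_i dot (v i) (v i).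
Proof. by apply: eq_bigr => i _; rewrite dot_norm. Qed.

Lemma sqnorm_gt0 (v : {ffun 'I_n -> H}) : v != 0 -> 0 < sqnorm v.
Proof.
move=> v0; rewrite lt0r sumr_ge0 ?andbT => [|i _]; last exact: sqr_ge0.
apply: contraNneq v0 => /psumr_eq0P h; apply/eqP/ffunP => i; rewrite ffunE.
have /eqP := h (fun i _ => sqr_ge0 _) i isT.
by rewrite sqrf_eq0 normr_eq0 => /eqP.
Qed.

Lemma step_constraints_diff (A : 'I_n -> H -> set H) (v1 x1 v2 x2 : 'I_n -> H) :
  op_class dot mu l A ->
  (forall i, A i (x1 i) (opval L v1 x1 i)) ->
  (forall i, A i (x2 i) (opval L v2 x2 i)) ->
  step_constraints L mu l dot (fun i => v1 i - v2 i) (fun i => x1 i - x2 i).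
Proof.
move=> Acls A1 A2 i; have [_ smono lip] := Acls i.
have -> : opval L (fun i => v1 i - v2 i) (fun i => x1 i - x2 i) i =
    opval L v1 x1 i - opval L v2 x2 i.
  rewrite /opval; under eq_bigr do rewrite scalerBr.
  by rewrite sumrB addrACA -opprD [- (x1 i - x2 i)]opprD addrACA -opprD.
split; first by rewrite dot_norm; exact: smono.
rewrite !dot_norm -exprMn ler_pXn2r ?nnegrE //; first exact: lip.
by have /andP[m0 ml] := mu_l i; rewrite mulr_ge0 // ltW // (le_lt_trans m0).
Qed.

Lemma worst_case_le_rate_bound c gamma W : admissible c (gamma *: W) ->
  (worst_case dot L mu l gamma W <= rate_bound L mu l c (gamma *: W))%E.
Proof.
move=> [[Ws _] _ _]; apply: ge_ereal_sup => _ [tau + <-].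
move=> [A [v1 [x1 [v1' [v2 [x2 [v2' [Acls [s1 s2 v12] st1 st2 ->]]]]]]]].
apply: le_ereal_inf_tmp => _ [p [[Sp phi0 lam0 _] pW] <-]; rewrite lee_fin.
have /iter_stepP[A1 e1] := st1; have /iter_stepP[A2 e2] := st2.
have v0 : 0 < sqnorm (v1 - v2) by rewrite sqnorm_gt0 // subr_eq0; apply/eqP.
rewrite ler_pdivrMr //.
have := weak_duality Sp phi0 lam0 _ _ (step_constraints_diff Acls A1 A2).
rewrite pW => /(_ Ws); rewrite sumrB s1 s2 subrr => /(_ erefl).
rewrite !sqnorm_dot; suff eqv i : v1 i - v2 i - \sum_j (gamma *: W) i j *: (x1 j - x2 j)
    = (v1' - v2') i.
  congr (_ <= _ * _); apply: eq_bigr => i _; first by rewrite eqv.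
  by rewrite !ffunE.
rewrite !ffunE e1 e2; under eq_bigr do rewrite scalerBr.
by rewrite sumrB [- (_ - \sum_j _)]opprD addrACA -opprD.
Qed.

Lemma rate_bound_le_worst_case c gamma W : (2 <= n)%N ->
  admissible c (gamma *: W) -> dim_ge H (2 * n)%N ->
  (rate_bound L mu l c (gamma *: W) <= worst_case dot L mu l gamma W)%E.
Proof.
move=> n2 adm dimH; have [[Ws _] _ _] := adm.
have key psi : (worst_case dot L mu l gamma W < psi%:E)%E ->
    (rate_bound L mu l c (gamma *: W) <= psi%:E)%E.
  move=> wc_psi.
  have [v x v0 [i0 vi0] vx|p [Sp phi0 lam0 pW <-]] :=
    @strong_duality _ _ L mu l L_trig L_diag mu_l _ dot _ psi n2 Ws dimH; last first.
    by apply: optval_le; split=> //; split=> //; rewrite pW.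
  have /choice[A AP] : forall i, exists A : H -> set H,
      [/\ maximal_monotone dot A, strongly_monotone dot (mu i) A,
          lipschitz_op (l i) A, A 0 0 & A (x i) (opval L v x i)].
    move=> i; have [vx1 vx2] := vx i; apply: two_point_operator => //.
      by rewrite -dot_norm.
    have /andP[m0 ml] := mu_l i; have l0 := le_lt_trans m0 ml.
    rewrite -(@ler_pXn2r _ 2) ?nnegrE ?mulr_ge0 ?(ltW l0) //.
    by rewrite exprMn -!dot_norm.
  (* the second run starts, and stays, at the origin *)
  pose fv : {ffun 'I_n -> H} := [ffun i => v i].
  pose fx : {ffun 'I_n -> H} := [ffun i => x i].
  pose fv' : {ffun 'I_n -> H} :=
    [ffun i => v i - \sum_j (gamma *: W) i j *: x j].
  have fv0 : fv != 0.
    by apply: contraNneq vi0 => /ffunP/(_ i0); rewrite !ffunE => ->.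
  have := sqnorm_gt0 fv0 => sv0.
  have : contraction_ratios dot L mu l gamma W (sqnorm fv' / sqnorm fv).
    exists A, fv, fx, fv', 0, 0, 0; split.
    - by move=> i; have [] := AP i.
    - split; last by apply/eqP.
        by rewrite -[RHS]v0; apply: eq_bigr => i _; rewrite ffunE.
      by rewrite big1 // => i _; rewrite ffunE.
    - apply/iter_stepP; split=> i; last first.
        by rewrite !ffunE; congr (_ - _); apply: eq_bigr => j _; rewrite ffunE.
      rewrite ffunE; have [_ _ _ _] := AP i; congr (A i _ _).
      by rewrite /opval !ffunE; congr (_ + _ - _); apply: eq_bigr => j _;
        rewrite ffunE.
    - apply/iter_stepP; split=> i; last first.
        rewrite ffunE big1 ?subr0 // => j _; rewrite ffunE scaler0 //.
      rewrite ffunE /opval !ffunE big1 => [|j _]; last by rewrite ffunE scaler0.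
      by rewrite addr0 subr0; have [] := AP i.
    - by rewrite !subr0.
  move=> cr.
  have : ((sqnorm fv' / sqnorm fv)%:E < psi%:E)%E.
    apply: le_lt_trans wc_psi; apply: ereal_sup_ubound.
    by exists (sqnorm fv' / sqnorm fv).
  rewrite lte_fin ltr_pdivrMr // !sqnorm_dot.
  by congr (_ < _ * _); apply: eq_bigr => i _; rewrite ffunE.
move: key; case: (worst_case dot L mu l gamma W) => [w| |] key.
- apply/lee_addgt0Pr => e e0; apply: key.
  by rewrite lte_fin ltrDl.
- by rewrite leey.
- have -> : rate_bound L mu l c (gamma *: W) = -oo%E; last by [].
  by apply: eq_ninfty => r; apply: key; rewrite ltNyr.
Qed.

End WorstCase.

(** * The contraction factor and its optimal tuning *)

Theorem theorem8 (R : realType) (H : completeNormedModType R)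
  (dot : {dot H for idfun}) (dot_norm : forall x : H, dot x x = `|x| ^+ 2)
  (n : nat) (n_ge2 : (2 <= n)%N)
  (L : 'M[R]_n) (L_trig : is_trig_mx L) (L_diag : forall i, L i i < 1)
  (c : R) (c_gt0 : 0 < c)
  (mu l : 'I_n -> R) (mu_l : forall i, 0 <= mu i < l i) :
  (* (i) *)
  (forall (gamma : R) (W : 'M[R]_n), admissible c (gamma *: W) ->
     (worst_case dot L mu l gamma W <= rate_bound L mu l c (gamma *: W))%E
     /\ (dim_ge H (2 * n)%N ->
         rate_bound L mu l c (gamma *: W) = worst_case dot L mu l gamma W))
  /\
  (* (ii) *)
  [/\ optval (feasD L mu l c) (@dpsi R n)
        = ereal_inf [set rate_bound L mu l c W | W in admissible c],
      (forall p, optsol (feasD L mu l c) (@dpsi R n) p ->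
         forall (gamma : R) (W : 'M[R]_n), gamma *: W = dW p ->
         [/\ admissible c (gamma *: W),
             rate_bound L mu l c (gamma *: W) = (dpsi p)%:E
           & forall W', admissible c W' ->
               (rate_bound L mu l c (gamma *: W) <= rate_bound L mu l c W')%E])
    & (forall (gamma : R) (W : 'M[R]_n), admissible c (gamma *: W) ->
         (rate_bound L mu l c (gamma *: W)
            = optval (feasD L mu l c) (@dpsi R n)
          <-> forall W', admissible c W' ->
               (rate_bound L mu l c (gamma *: W) <= rate_bound L mu l c W')%E))]
  /\
  (* (iii) *)
  (forall W : 'M[R]_n,
   [/\ optval (feasD_scaled L mu l c W) (fun q => dpsi q.2)
         = ereal_inf [set rate_bound L mu l c (gamma *: W)
                     | gamma in [set g : R | admissible c (g *: W)]],
       (forall q, optsol (feasD_scaled L mu l c W) (fun q => dpsi q.2) q ->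
          [/\ admissible c (q.1 *: W),
              rate_bound L mu l c (q.1 *: W) = (dpsi q.2)%:E
            & forall g : R, admissible c (g *: W) ->
                (rate_bound L mu l c (q.1 *: W)
                   <= rate_bound L mu l c (g *: W))%E])
     & (forall gamma : R, admissible c (gamma *: W) ->
          (rate_bound L mu l c (gamma *: W)
             = optval (feasD_scaled L mu l c W) (fun q => dpsi q.2)
           <-> forall g : R, admissible c (g *: W) ->
                (rate_bound L mu l c (gamma *: W)
                   <= rate_bound L mu l c (g *: W))%E))]).

Proof.
pose Dfix W := feasD_fixed L mu l c W.
have solW p : optsol (feasD L mu l c) (@dpsi R n) p ->
    admissible c (dW p) /\ rate_bound L mu l c (dW p) = (dpsi p)%:E.
  move=> [pD pmin]; split; first by case: pD.
  by apply: optsol_optval; split=> // q [qD _]; exact: pmin.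
have jointW : optval (feasD L mu l c) (@dpsi R n)
    = ereal_inf [set rate_bound L mu l c W | W in admissible c].
  apply: (optval_bigcup (F := Dfix)) => [W _ p [pD _]|p pD]; first by exists p.
  by exists (dW p); [case: pD | exists p].
split; first move=> gamma W adm; [split|split].
- exact: worst_case_le_rate_bound.
- move=> dimH; apply/eqP; rewrite eq_le; apply/andP; split.
    exact: rate_bound_le_worst_case.
  exact: worst_case_le_rate_bound.
- split=> // [p popt gamma W ->|gamma W adm].
    have [adm rp] := solW p popt; split=> // W' adm'.
    rewrite rp -(optsol_optval popt) jointW.
    by apply: ereal_inf_lbound; exists W'.
  by rewrite jointW; exact: ereal_inf_eq_min.
- move=> W.
  pose Dscaled g := feasD_fixed L mu l c (g *: W).
  pose adm : set R := [set g : R | admissible c (g *: W)].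
  have jointg : optval (feasD_scaled L mu l c W) (fun q => dpsi q.2)
      = ereal_inf [set rate_bound L mu l c (g *: W) | g in adm].
    apply: (optval_bigcup (F := Dscaled)) => [g _ p [pD pW]|[g p] [/= pD pW]].
      by exists (g, p).
    by exists g; [rewrite /adm /= -pW; case: pD | exists p].
  split=> // [[g p] qopt|g admg] /=.
  + have [[/= pD pW] qmin] := qopt.
    split; first by rewrite -pW; case: pD.
      apply: optsol_optval; split=> // p' [pD' pW'].
      exact: (qmin (g, p')).
    move=> g' admg'; have -> : rate_bound L mu l c (g *: W) =
        ereal_inf [set rate_bound L mu l c (g *: W) | g in adm].
      rewrite -jointg (optsol_optval qopt) /=.
      apply: optsol_optval; split=> // p' [pD' pW'].
      exact: (qmin (g, p')).
    by apply: ereal_inf_lbound; exists g'.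
  + rewrite jointg.
    exact: (ereal_inf_eq_min (fun g => rate_bound L mu l c (g *: W)) admg).
Qed.
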